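(* Let $n\ge 1$ and let the unit cube $Q^n=[0,1]^n$ be covered by $n$ closed sets $X_1,\ldots,X_n\subseteq Q^n$. Then there exist $i\in\{1,\ldots,n\}$ and a connected component of $X_i$ that intersects both opposite facets $F_i^+=\{x\in Q^n : x_i=1\}$ and $F_i^-=\{x\in Q^n : x_i=0\}$ of $Q^n$. *)

(* Defs.v *)
From HB Require Import structures.
From mathcomp Require Import all_boot all_order all_algebra.
From mathcomp Require Import all_classical all_reals all_analysis.
Set Implicit Arguments.
Unset Strict Implicit.
Unset Printing Implicit Defensive.
Import Order.TTheory GRing.Theory Num.Theory.
Import numFieldNormedType.Exports.
Local Open Scope classical_set_scope.
Local Open Scope ring_scope.

(* Points of R^n are row vectors; 'rV[R]_n carries the product topology. *)
Definition unit_cube (R : realType) (n : nat) : set 'rV[R]_n :=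
  [set x | forall j : 'I_n, 0 <= x ord0 j <= 1].

Definition facet_plus (R : realType) (n : nat) (i : 'I_n) : set 'rV[R]_n :=
  [set x | unit_cube x /\ x ord0 i = 1].

Definition facet_minus (R : realType) (n : nat) (i : 'I_n) : set 'rV[R]_n :=
  [set x | unit_cube x /\ x ord0 i = 0].

Definition is_connected_component (T : topologicalType) (A C : set T) : Prop :=
  exists2 x, A x & C = connected_component A x.

(* Main.v *)
Require Import Defs.
From HB Require Import structures.
From mathcomp Require Import all_boot all_order all_algebra.
From mathcomp Require Import all_classical all_reals all_analysis.
Set Implicit Arguments.
Unset Strict Implicit.
Unset Printing Implicit Defensive.
Import Order.TTheory GRing.Theory Num.Theory.
Import numFieldNormedType.Exports.
Local Open Scope ring_scope.

(** In a compact space connected components coincide with quasi-components.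
So if no component of [X i] meets both facets, then [X i] together with these
facets is covered by two closed sets [A i] (containing the facet [x_i = 0]) and
[B i] (containing [x_i = 1]) at positive distance.  On a fine grid let [a i] be
0 near [A i] and 1 elsewhere.  The cup product of the coboundaries of the [a i],
summed mod 2 over all grid cells, telescopes to its boundary values and equals
1; so on some cell every [a i] takes both values.  But a corner of that cell
lies in some [X i], and then the whole cell is close to [A i] or to [B i], so
that [a i] is constant on it. *)

(** * Mod 2 cup products on the lattice *)

(** Addition in [bool] is xor and each unordered pair occurs twice; this is the cancellation behind
    [d d = 0]. *)
Lemma sum_offdiag_sym_bool (n : nat) (J : {set 'I_n}) (f : 'I_n -> 'I_n -> bool) :
  (forall j l, f j l = f l j) ->
  \sum_(j in J) \sum_(l in J :\ j) f j l = 0.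
Proof.
move=> fC.
have -> : \sum_(j in J) \sum_(l in J :\ j) f j l =
    \sum_(j in J) (\sum_(l in J | (l < j)%N) f j l) +
    \sum_(j in J) (\sum_(l in J | (j < l)%N) f j l).
  rewrite -big_split; apply: eq_bigr => j _.
  rewrite (bigID (fun l : 'I_n => (l < j)%N)) /=; congr (_ + _); apply: eq_bigl => l;
    rewrite !inE -(inj_eq val_inj) /=; case: (l \in J); case: (ltngtP l j) => //.
rewrite [X in X + _](exchange_big_dep (mem J)) //=; last by move=> j l _ /andP[].
rewrite -[LHS]/(addb _ _).
set A := (X in X (+) _); set B := (X in _ (+) X).
suff -> : A = B by rewrite addbb.
apply: eq_bigr => j jJ; apply: eq_big => [l|l _]; last exact: fC.
by rewrite jJ.
Qed.

Section LatticeForms.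
Variables (n : nat).
Implicit Types (i j l : 'I_n) (p q u v : 'I_n -> nat) (J : {set 'I_n}) (s : seq 'I_n).

Definition upd p j x : 'I_n -> nat := fun l => if l == j then x else p l.
Definition inc p j := upd p j (p j).+1.

Lemma updC p i j x y : i != j -> upd (upd p i x) j y = upd (upd p j y) i x.
Proof.
move=> ij; apply/funext => l; rewrite /upd; case: eqP => // -> .
by rewrite eq_sym (negbTE ij).
Qed.

Lemma upd_upd p j x y : upd (upd p j x) j y = upd p j y.
Proof. by apply/funext => l; rewrite /upd; case: eqP. Qed.

Lemma inc_upd p j x : inc (upd p j x) j = upd p j x.+1.
Proof. by rewrite /inc upd_upd /upd eqxx. Qed.

Lemma incC p i j : inc (inc p i) j = inc (inc p j) i.
Proof.
have [->//|ij] := eqVneq i j.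
by rewrite /inc updC //; congr upd; [congr upd|]; rewrite /upd 1?(eq_sym j) (negbTE ij).
Qed.

Variable a : 'I_n -> ('I_n -> nat) -> bool.

(* The mod 2 coefficient at [p], in the directions [J], of the lattice cup
   product of the coboundaries of [a i], [i] in [s]. *)
Fixpoint cup s J p : bool :=
  if s is i :: s' then
    \sum_(j in J) (a i (inc p j) + a i p) * cup s' (J :\ j) (inc p j)
  else 1.

(** A product of coboundaries is a cocycle. After expanding and applying the induction hypothesis to
    the inner sums, the terms with [a i (inc (inc p j) l)] on the left and with [a i p] on the right
    are symmetric in [j], [l] and cancel. The remaining double sums differ by exchanging [j] and
    [l]. *)
Lemma cup_closed s J p : #|J| = (size s).+1 ->
  \sum_(j in J) cup s (J :\ j) (inc p j) = \sum_(j in J) cup s (J :\ j) p.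
Proof.
elim: s J p => [|i s IH] J p Jsz; first by [].
have Jsz' j : j \in J -> #|J :\ j| = (size s).+1.
  by move=> jJ; move: Jsz; rewrite (cardsD1 j) jJ => -[].
rewrite /=.
have -> : \sum_(j in J) \sum_(l in J :\ j)
    (a i (inc (inc p j) l) + a i (inc p j)) * cup s (J :\ j :\ l) (inc (inc p j) l)
  = \sum_(j in J) a i (inc p j) * \sum_(l in J :\ j) cup s (J :\ j :\ l) (inc p j).
  under eq_bigr => j jJ.
    under eq_bigr do rewrite mulrDl.
    rewrite big_split /= -big_distrr /= IH ?Jsz' //; over.
  rewrite big_split /= sum_offdiag_sym_bool ?add0r // => j l.
  by rewrite incC !finset.setDDl finset.setUC.
have -> : \sum_(j in J) \sum_(l in J :\ j)
    (a i (inc p l) + a i p) * cup s (J :\ j :\ l) (inc p l)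
  = \sum_(j in J) \sum_(l in J :\ j) a i (inc p l) * cup s (J :\ j :\ l) (inc p l).
  under eq_bigr => j jJ.
    under eq_bigr do rewrite mulrDl.
    rewrite big_split /= -big_distrr /= IH ?Jsz' //; over.
  rewrite big_split /= -big_distrr /= [X in _ + _ * X]sum_offdiag_sym_bool.
    by rewrite mulr0 addr0.
  by move=> j l; rewrite !finset.setDDl finset.setUC.
rewrite [RHS](exchange_big_dep (mem J)) /=; last by move=> j l _; rewrite !inE => /andP[].
apply: eq_bigr => j jJ; rewrite big_distrr /=.
apply: eq_big => [l|l _]; last by rewrite !finset.setDDl finset.setUC.
by rewrite !inE jJ andbT andbC eq_sym.
Qed.

(* Leibniz rule, with [cup_closed] supplying closedness of the second factor. *)
Lemma cup_cons i s J p : #|J| = (size s).+1 ->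
  cup (i :: s) J p = \sum_(j in J)
    (a i (inc p j) * cup s (J :\ j) (inc p j) + a i p * cup s (J :\ j) p).
Proof.
move=> Jsz /=; under eq_bigr do rewrite mulrDl.
by rewrite !big_split /= -!big_distrr /= cup_closed.
Qed.

(** Steps in directions of [J] keep the [j]-th coordinate, so the factor coming from [a j]
    vanishes. *)
Lemma cup_facet0 s J p j : j \in s -> j \notin J ->
  (forall q, q j = p j -> a j q = a j p) -> cup s J p = 0.
Proof.
elim: s J p => [//|i s IH] J p js jJ cst /=.
have incj l : l \in J -> inc p l j = p j.
  by move=> lJ; rewrite /inc /upd; case: eqP => // jl; rewrite jl lJ in jJ.
apply: big1 => l lJ; have [ij|ij] := eqVneq i j.
  rewrite ij (cst (inc p l)) ?incj //.
  by rewrite -[X in X * _]/(addb _ _) addbb mul0r.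
rewrite IH ?mulr0 //.
- by move: js; rewrite inE eq_sym (negbTE ij).
- by rewrite !inE (negbTE jJ) andbF.
- by move=> q qj; rewrite !cst ?incj // qj incj.
Qed.

(** A nonzero product has a nonzero term: an edge path from [p] using each direction at most once,
    each of whose edges changes the corresponding function. The ends of the edge for [i] serve as
    [u] and [v]. *)
Lemma cup_neq0 s J p i : cup s J p -> i \in s ->
  exists u v, [/\ forall l, (p l <= u l <= (p l).+1)%N,
                  forall l, (p l <= v l <= (p l).+1)%N & a i u != a i v].
Proof.
(* The sharper bound allows motion only in directions of [J], so the induction can pass to [inc p j]
   and [J :\ j]. *)
suff: cup s J p -> i \in s ->
  exists u v, [/\ forall l, (p l <= u l <= p l + (l \in J))%N,
                  forall l, (p l <= v l <= p l + (l \in J))%N & a i u != a i v].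
  move=> H /H {}H /H [u [v [pu pv uv]]]; exists u, v; split=> // l;
    [have /andP[-> /leq_trans->//] := pu l|have /andP[-> /leq_trans->//] := pv l];
    by rewrite -addn1 leq_add2l leq_b1.
elim: s J p => [//|i' s IH] J p /= Wp.
have [j jJ] : exists2 j, j \in J &
    (a i' (inc p j) + a i' p) * cup s (J :\ j) (inc p j) = true.
  apply: contrapT => no; move: Wp; rewrite big1 // => j jJ.
  by apply/negbTE/negP => h; apply: no; exists j.
move=> /andP[aj /IH{}IH].
have bnd u : (forall l, (inc p j l <= u l <= inc p j l + (l \in J :\ j))%N) ->
    forall l, (p l <= u l <= p l + (l \in J))%N.
  move=> h l; have := h l; rewrite /inc /upd !inE; case: eqP => [->|_] //=.
  by rewrite jJ addn0 addn1 => /andP[/ltnW-> ->].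
rewrite inE => /orP[/eqP->|/IH[u [v [/bnd pu /bnd pv uv]]]]; last by exists u, v.
exists (inc p j), p; split=> [l|l|]; last by move: aj; case: (a _ _); case: (a _ _).
  by rewrite /inc /upd; case: eqP => [->|_]; rewrite ?jJ ?addn1 leqnn ?leqnSn ?leq_addr.
by rewrite leqnn leq_addr.
Qed.

(** * Sums over a box and a discrete Stokes formula *)

Variable k : nat.

(** Iterated one-coordinate sums, so that any single coordinate can be moved innermost ([box_rem])
    and telescoped. *)
Fixpoint box s (f : ('I_n -> nat) -> bool) q : bool :=
  if s is j :: s' then \sum_(x < k) box s' f (upd q j x) else f q.

Lemma box_ext s f g q : (forall p, f p = g p) -> box s f q = box s g q.
Proof. by move=> /funext ->. Qed.

Lemma box0 s q : box s (fun=> 0) q = 0.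
Proof. by elim: s q => //= j s IH q; apply: big1. Qed.

Lemma box_sum (I : finType) (P : pred I) s (f : I -> ('I_n -> nat) -> bool) q :
  box s (fun p => \sum_(i | P i) f i p) q = \sum_(i | P i) box s (f i) q.
Proof.
elim: s q => //= j s IH q; rewrite exchange_big /=.
by apply: eq_bigr => x _.
Qed.

Lemma box_upd s f q j x : j \notin s ->
  box s f (upd q j x) = box s (fun p => f (upd p j x)) q.
Proof.
elim: s q => //= i s IH q; rewrite inE negb_or => /andP[ji js].
by apply: eq_bigr => y _; rewrite updC // IH.
Qed.

Lemma box_rem s f q j : uniq s -> j \in s ->
  box s f q = box (rem j s) (fun p => \sum_(x < k) f (upd p j x)) q.
Proof.
elim: s q => //= i s IH q /andP[iss us]; rewrite inE.
have [<- _|ij] := eqVneq i j.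
  by rewrite box_sum; apply: eq_bigr => x _; rewrite box_upd.
by move=> /= js; apply: eq_bigr => x _; rewrite IH.
Qed.

Lemma box_neq0 s f q : box s f q ->
  exists2 p, f p & forall l, if l \in s then (p l < k)%N else p l == q l.
Proof.
elim: s q => [|j s IH] q /=; first by exists q.
move=> bq; have [x /IH[p fp pl]] : exists x : 'I_k, box s f (upd q j x).
  apply: contrapT => no; move: bq; rewrite big1 // => x _.
  by apply/negbTE/negP => h; apply: no; exists x.
exists p => // l; have := pl l; rewrite inE /upd.
by case: (l \in s); rewrite ?orbT ?orbF //; case: (l == j) => // /eqP->.
Qed.

Lemma telescope_upd (f : ('I_n -> nat) -> bool) p j :
  \sum_(x < k) (f (inc (upd p j x) j) + f (upd p j x)) =
  f (upd p j k) + f (upd p j 0%N).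
Proof.
under eq_bigr do rewrite inc_upd.
elim: k => [|m IH]; first by rewrite big_ord0 -[RHS]/(addb _ _) addbb.
rewrite big_ord_recr IH /=.
by case: (f _) (f _) (f _) => [] [] [].
Qed.

Hypothesis a_lo : forall i p, p i = 0%N -> a i p = false.
Hypothesis a_hi : forall i p, p i = k -> a i p = true.

(** By [cup_cons] the summand is a sum of differences in the directions [j], so only the two faces
    orthogonal to each [j] survive. If [j] is not the head [i], then [a j] is constant on these
    faces and [cup_facet0] applies. For [j = i] the lower face has [a i = 0] and the upper one
    [a i = 1], which leaves the same sum for the tail. *)
Lemma box_cup s q : uniq s -> box s (cup s [set j in s]) q = 1.
Proof.
elim: s q => [//|i s IH] q /[dup] us' /= /andP[iss us].
pose J := [set j in i :: s].
have Jsz : #|J| = (size s).+1 by rewrite cardsE; apply/card_uniqP.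
pose f j p := a i p * cup s (J :\ j) p.
rewrite -[LHS]/(box (i :: s) (cup (i :: s) J) q).
rewrite (@box_ext _ _ (fun p => \sum_(j in J) (f j (inc p j) + f j p))); last first.
  by move=> p; rewrite cup_cons.
rewrite box_sum.
have tele j : j \in J -> box (i :: s) (fun p => f j (inc p j) + f j p) q =
    box (rem j (i :: s)) (fun p => f j (upd p j k) + f j (upd p j 0%N)) q.
  rewrite inE => js; rewrite (box_rem _ _ us' js); apply: box_ext => p.
  exact: telescope_upd.
under eq_bigr => j jJ do rewrite tele //.
rewrite (bigD1 i) /=; last by rewrite !inE eqxx.
rewrite eqxx [X in _ + X]big1 ?addr0; last first.
  move=> j /andP[]; rewrite inE inE => /orP[->//|js] /negbTE ji; rewrite eq_sym ji.
  rewrite (@box_ext _ _ (fun=> 0)); first exact: (@box0 (i :: rem j s)).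
  have updj p x : upd p j x j = x by rewrite /upd eqxx.
  move=> p; rewrite /f !(@cup_facet0 _ _ _ j) ?mulr0 ?addr0 // ?inE ?eqxx // => r.
    by rewrite updj => rj; rewrite !a_lo ?updj.
  by rewrite updj => rj; rewrite !a_hi ?updj.
have -> : f i = (fun p => a i p * cup s [set j in s] p).
  apply/funext => p; rewrite /f; congr (_ * cup _ _ _).
  by apply/setP => l; rewrite !inE; case: eqP => [->|] //=; rewrite (negbTE iss).
rewrite -(IH (upd q i k) us) box_upd //; apply: box_ext => p.
by rewrite a_hi ?a_lo /upd ?eqxx // mul1r mul0r addr0.
Qed.

End LatticeForms.

Lemma cubical_sperner (n k : nat) (a : 'I_n -> ('I_n -> nat) -> bool) :
  (forall i p, p i = 0%N -> a i p = false) ->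
  (forall i p, p i = k -> a i p = true) ->
  exists2 p : 'I_n -> nat, forall l, (p l < k)%N &
    forall i, exists u v,
      [/\ forall l, (p l <= u l <= (p l).+1)%N,
          forall l, (p l <= v l <= (p l).+1)%N & a i u != a i v].
Proof.
move=> lo hi.
have := box_cup lo hi (fun=> 0%N) (enum_uniq 'I_n).
move=> /(@box_neq0 _ _ _ _ _)[p cp pk]; exists p => [l|i].
  by have := pk l; rewrite mem_enum.
by apply: cup_neq0 cp _; rewrite mem_enum.
Qed.

Local Open Scope classical_set_scope.


(** * Components and quasi-components of compact sets *)

(** The traces on [K] generate a proper filter; a cluster point of it lies in every closed
    member. *)
Lemma compact_directed_bigcap (T : topologicalType) (K : set T)
    (F : set (set T)) :
  compact K -> F !=set0 ->
  (forall D E, F D -> F E -> F (D `&` E)) ->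
  (forall D, F D -> closed D) ->
  (forall D, F D -> (K `&` D) !=set0) ->
  exists2 x, K x & forall D, F D -> D x.
Proof.
move=> cK F0 FI Fc FK.
have PF : ProperFilter (filter_from F (fun D => K `&` D)).
  apply: filter_from_proper => //; apply: filter_from_filter => // D E FD FE.
  by exists (D `&` E); [exact: FI|rewrite setIACA setIid].
have [|x [Kx clx]] := cK _ PF; first by case: F0 => D FD; exists D => // y [].
exists x => // D FD; apply: Fc => // W xW.
have [|y [[_ Dy] Wy]] := clx (K `&` D) W _ xW; first by exists D.
by exists y.
Qed.

Section QuasiComponents.
Variables (T : topologicalType) (K : set T).

(** For closed [K] these are the relatively clopen subsets, expressed without the subspace
    topology. *)
Definition clopen_part (D : set T) :=
  [/\ closed D, closed (K `\` D) & D `<=` K].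

Lemma clopen_partI D E : clopen_part D -> clopen_part E -> clopen_part (D `&` E).
Proof.
move=> [cD cKD DK] [cE cKE EK]; split; first exact: closedI.
  by rewrite setDIr; exact: closedU.
by move=> x [/DK].
Qed.

Lemma clopen_part_full : closed K -> clopen_part K.
Proof. by move=> cK; split=> //; rewrite setDv; exact: closed0. Qed.

Lemma clopen_partD D : clopen_part D -> clopen_part (K `\` D).
Proof. by move=> [cD cKD DK]; split=> //; rewrite setDD setIidr. Qed.

Definition quasi_component (x : T) : set T :=
  \bigcap_(D in [set D | clopen_part D /\ D x]) D.

Lemma quasi_component_sep x P : closed K -> K x -> compact P ->
  quasi_component x `&` P = set0 ->
  exists2 D, clopen_part D & D x /\ D `&` P = set0.
Proof.
move=> cK Kx cP QP; apply: contrapT => no.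
have [||||y Py Qy] := @compact_directed_bigcap T P
    [set D | clopen_part D /\ D x] cP.
- by exists K; split=> //; exact: clopen_part_full.
- by move=> D E [pD Dx] [pE Ex]; split; [exact: clopen_partI|].
- by move=> D [[]].
- move=> D [pD Dx]; apply: contrapT => /nonemptyPn PD.
  by apply: no; exists D => //; rewrite setIC.
by rewrite -[False]/(set0 y) -QP; split.
Qed.

Hypothesis normalT : forall A B : set T, closed A -> closed B -> A `&` B = set0 ->
  exists U V, [/\ open U, open V, A `<=` U, B `<=` V & U `&` V = set0].

(** If [B] is relatively clopen in [Q], normality encloses [B] and its complement in disjoint open
    [U], [V]. The compact rest of [K] misses [Q], so some clopen part [D] around [x] lies in the
    union of [U] and [V]. Cutting [D] down to the side of [x] gives a clopen part, which contains
    all of [Q]. *)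
Lemma quasi_component_connected x : compact K -> closed K -> K x ->
  connected (quasi_component x).
Proof.
move=> cptK cK Kx B B0 [C oC BC] [C' cC' BC'].
set Q := quasi_component x in BC BC' *.
have cQ : closed Q by apply: closed_bigI => D [[]].
have QB : Q `\` B = Q `&` ~` C.
  by rewrite BC setDIr setDv set0U setDE.
have [||| U [V [oU oV BU QV UV]]] := @normalT B (Q `\` B).
- by rewrite BC'; exact: closedI.
- by rewrite QB; apply: closedI => //; exact: open_closedC.
- exact: setDIK.
have UVF z : U z -> V z -> False by move=> Uz Vz; rewrite -[False]/(set0 z) -UV.
have QUV : Q `<=` U `|` V.
  by move=> z Qz; have [/BU|Bz] := pselect (B z); [left|right; exact: QV].
have [||D pD [Dx DUV]] := @quasi_component_sep x (K `&` ~` (U `|` V)) cK Kx.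
- by apply: compact_closedI => //; apply: open_closedC; exact: openU.
- by apply/seteqP; split=> z // [/QUV ? [_]].
have [cD cKD DK] := pD.
have DUV' z : D z -> U z \/ V z.
  move=> Dz; apply: contrapT => nUV.
  by rewrite -[False]/(set0 z) -DUV; split=> //; split=> //; exact: DK.
have part (U1 V1 : set T) : open U1 -> open V1 ->
    (forall z, U1 z -> V1 z -> False) -> (forall z, D z -> U1 z \/ V1 z) ->
    clopen_part (D `&` ~` V1).
  move=> oU1 oV1 dUV cUV; split; last by move=> z [/DK].
    by apply: closedI => //; exact: open_closedC.
  (* Inside [D], lying in [V1] is the same as lying outside [U1], a closed condition. *)
  rewrite (_ : _ `\` _ = (K `\` D) `|` (D `&` ~` U1)).
    by apply: closedU => //; apply: closedI => //; exact: open_closedC.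
  apply/seteqP; split=> z /=.
    move=> [Kz nD]; have [Dz|nDz] := pselect (D z); last by left.
    by right; split=> // Uz; apply: nD; split=> // /(dUV _ Uz).
  move=> [[Kz nDz]|[Dz nUz]]; first by split=> // -[].
  split; first exact: DK.
  by move=> [_]; apply; have [] := cUV _ Dz.
have [Ux|Vx] := DUV' _ Dx.
  have QD : Q `<=` D `&` ~` V.
    apply: bigcap_inf; split; first exact: (part U V).
    by split=> // /(UVF _ Ux).
  apply/seteqP; split=> z; first by rewrite BC => -[].
  by move=> Qz; apply: contrapT => nBz; have [_] := QD _ Qz; apply; exact: QV.
have QD : Q `<=` D `&` ~` U.
  apply: bigcap_inf; split; last by split=> // /UVF; exact.
  by apply: (part V U) => // [z Vz Uz|z /DUV' []]; [exact: (UVF z)|right|left].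
have [z Bz] := B0; have Qz : Q z by move: Bz; rewrite BC => -[].
by have [_] := QD _ Qz; case; exact: BU.
Qed.

(** If no such [D] exists, every clopen part containing the points of [P] in [K] meets [N], and by
    compactness all of them share some [x] in [N]. But the complement of a clopen part separating
    [x] from [P] is one of them. *)
Lemma component_separation N P : compact K -> closed K -> compact N -> compact P ->
  N `<=` K ->
  (forall x y, N x -> P y -> ~ connected_component K x y) ->
  exists2 D, clopen_part D & N `<=` D /\ D `&` P = set0.
Proof.
move=> cptK cK cN cP NK dis; apply: contrapT => no.
have [||||x Nx Fx] := @compact_directed_bigcap T N
    [set E | clopen_part E /\ K `&` P `<=` E] cN.
- by exists K; split=> [|z []//]; exact: clopen_part_full.
- move=> D E [pD PD] [pE PE]; split; first exact: clopen_partI.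
  by move=> z Pz; split; [exact: PD|exact: PE].
- by move=> D [[]].
- move=> E [pE PE]; apply: contrapT => /nonemptyPn NE; apply: no.
  exists (K `\` E); first exact: clopen_partD.
  split=> [z Nz|]; first by split; [exact: NK|move=> Ez; rewrite -[False]/(set0 z) -NE].
  by apply/seteqP; split=> z // [[Kz nE] Pz]; apply: nE; exact: PE.
have Kx := NK _ Nx.
have [|D pD [Dx DP]] := @quasi_component_sep x P cK Kx cP.
  apply/seteqP; split=> z // [Qz Pz]; apply: (dis x z Nx Pz).
  exists (quasi_component x) => //; split.
  - by move=> D [].
  - by apply: bigcap_inf; split=> //; exact: clopen_part_full.
  - exact: quasi_component_connected.
have [] : (K `\` D) x; last by [].
apply: Fx; split; first exact: clopen_partD.
by move=> z [Kz Pz]; split=> // Dz; rewrite -[False]/(set0 z) -DP.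
Qed.

End QuasiComponents.

(** * Positive distance and separation of facets *)

Lemma compact_closed_far (R : realType) (M : pseudoMetricType R) (A B : set M) :
  compact A -> closed B -> A `&` B = set0 ->
  exists2 d : R, 0 < d & forall x y, A x -> B y -> ~ ball x d y.
Proof.
move=> /compact_near_coveringP cA cB AB.
have cov x : A x -> \forall x' \near x & d \near 0^'+, forall y, B y -> ~ ball x' d y.
  move=> Ax; have /nbhs_ballP[e /= e0 eB] : nbhs x (~` B).
    apply: open_nbhs_nbhs; split; first exact: closed_openC.
    by move=> Bx; rewrite -[False]/(set0 x) -AB.
  near=> x' d => y By xdy; apply: (eB y) => //.
  apply: (@ball_splitr _ _ x').
    by apply: ball_sym; near: x'; apply: nbhsx_ballx; rewrite divr_gt0.
  apply: le_ball xdy; rewrite /=; near: d; apply: nbhs_right_le; by rewrite divr_gt0.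
have := cA _ _ (fun d x' => forall y, B y -> ~ ball x' d y) _ cov.
move=> H; near (0 : R)^'+ => d; exists d; first by near: d; exact: nbhs_right_gt.
have Kd : A `<=` (fun x' => forall y, B y -> ~ ball x' d y) by near: d; exact: H.
by move=> x y /Kd; exact.
Unshelve. all: by end_near. Qed.

Lemma unit_cube_compact (R : realType) (n : nat) : compact (@unit_cube R n).
Proof.
rewrite (_ : @unit_cube R n = [set v : 'rV[R]_n | forall i, `[0, 1]%classic (v ord0 i)]).
  by apply: (@rV_compact R n (fun=> `[0, 1]%classic)) => i; exact: segment_compact.
by apply/seteqP; split=> v vi j; have := vi j; rewrite /= in_itv.
Qed.

Lemma unit_cube_closed (R : realType) (n : nat) : closed (@unit_cube R n).
Proof. by apply: compact_closed; [exact: norm_hausdorff|exact: unit_cube_compact]. Qed.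

Lemma facet_closed (R : realType) (n : nat) (i : 'I_n) (c : R) :
  closed [set x : 'rV[R]_n | unit_cube x /\ x ord0 i = c].
Proof.
apply: closedI; first exact: unit_cube_closed.
apply: (@preimage_closed _ _ (fun x : 'rV[R]_n => x ord0 i) [set c]).
  by move=> x _; exact: coord_continuous.
exact: closed_eq.
Qed.

(** Whole facets are added to the two clopen parts of [X], so that the later boundary conditions
    hold at grid points outside [X] too. Disjointness survives because opposite facets are
    disjoint. *)
Lemma facet_separation (R : realType) (n : nat) (i : 'I_n) (X : set 'rV[R]_n) :
  closed X -> X `<=` @unit_cube R n ->
  (forall x y, X x -> facet_minus i x -> facet_plus i y ->
    ~ connected_component X x y) ->
  exists (A B : set 'rV[R]_n) (d : R),
    [/\ 0 < d, X `<=` A `|` B, @facet_minus R n i `<=` A, @facet_plus R n i `<=` B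
      & forall x y, A x -> B y -> ~ ball x d y].
Proof.
move=> cX Xcube dis.
have cptsub (Y : set 'rV[R]_n) : closed Y -> Y `<=` @unit_cube R n -> compact Y.
  by move=> cY; apply: subclosed_compact => //; exact: unit_cube_compact.
have cFm : closed (@facet_minus R n i) by exact: facet_closed.
have cFp : closed (@facet_plus R n i) by exact: facet_closed.
have [||||||D [cD cXD DX] [ND DP]] := @component_separation _ X
    (iffLR (@normal_openP R _) (@pseudometric_normal R _))
    (X `&` facet_minus i) (X `&` facet_plus i).
- exact: cptsub.
- exact: cX.
- by apply: cptsub; [exact: closedI|move=> x [/Xcube]].
- by apply: cptsub; [exact: closedI|move=> x [/Xcube]].
- by move=> x [].
- by move=> x y [Xx mx] [_ py]; exact: dis.
have DF z : D z -> facet_plus i z -> False.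
  by move=> Dz pz; rewrite -[False]/(set0 z) -DP; split=> //; split=> //; exact: DX.
have [|||d d0 dAB] := @compact_closed_far R _ (D `|` facet_minus i)
    ((X `\` D) `|` facet_plus i).
- apply: cptsub; first exact: closedU.
  by move=> x [/DX/Xcube|[]].
- exact: closedU.
- apply/seteqP; split=> z // [[Dz|mz] [[Xz nD]|pz]]; first by [].
  + exact: (DF z).
  + by apply: nD; exact: ND.
  + by move: mz pz => [_ z0] [_]; rewrite z0 => /esym/eqP; rewrite oner_eq0.
exists (D `|` facet_minus i), ((X `\` D) `|` facet_plus i), d; split=> //.
by move=> z Xz; have [Dz|nDz] := pselect (D z); [left; left|right; left].
Qed.

(* Coordinates are clamped to [k], so the boundary values demanded by
   [cubical_sperner] hold on all of [nat^n]. *)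
Definition grid_point (R : realType) (n k : nat) (v : 'I_n -> nat) : 'rV[R]_n :=
  \row_j ((minn (v j) k)%:R / k%:R).

Lemma grid_point_cube (R : realType) (n k : nat) (v : 'I_n -> nat) :
  (0 < k)%N -> unit_cube (grid_point R k v).
Proof.
move=> k0 j; rewrite mxE divr_ge0 ?ler0n //= ler_pdivrMr ?ltr0n // mul1r ler_nat.
exact: geq_minr.
Qed.

(** Balls are entrywise, so the mesh bound does not depend on [n]; clamping is inactive on this
    cell. *)
Lemma grid_point_near (R : realType) (n k : nat) (p v : 'I_n -> nat) (e : R) :
  (forall l, (p l < k)%N) -> (forall l, (p l <= v l <= (p l).+1)%N) ->
  0 < e -> 1 / k%:R < e -> ball (grid_point R k p) e (grid_point R k v).
Proof.
move=> pk pv e0 ke; split=> // i j; rewrite /ball /= !mxE.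
have /andP[pvj vpj] := pv j; have pkj := pk j.
have vk : (v j <= k)%N by exact: leq_trans vpj pkj.
rewrite (minn_idPl (ltnW pkj)) (minn_idPl vk) -mulrBl.
apply: le_lt_trans ke; rewrite normrM [`|k%:R^-1|]ger0_norm ?invr_ge0 ?ler0n //.
apply: ler_wpM2r; first by rewrite invr_ge0 ler0n.
by rewrite distrC -natrB // ger0_norm ?ler0n // (ler_nat _ _ 1) leq_subLR addn1.
Qed.

Theorem theorem4p3 (R : realType) (n : nat) (n_ge1 : (1 <= n)%N)
    (X : 'I_n -> set 'rV[R]_n)
    (X_closed : forall i, closed (X i))
    (X_sub : forall i, X i `<=` unit_cube (R:=R) (n:=n))
    (X_cover : unit_cube (R:=R) (n:=n) `<=` \bigcup_i X i) :
  exists (i : 'I_n) (C : set 'rV[R]_n),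
    [/\ is_connected_component (X i) C,
        C `&` facet_plus i !=set0 &
        C `&` facet_minus i !=set0].
Proof.
apply: contrapT => no.
have sep i := @facet_separation R n i (X i) (X_closed i) (X_sub i).
have {}sep i : exists ABd : set 'rV[R]_n * set 'rV[R]_n * R,
    [/\ 0 < ABd.2, X i `<=` ABd.1.1 `|` ABd.1.2, @facet_minus R n i `<=` ABd.1.1,
        @facet_plus R n i `<=` ABd.1.2
      & forall x y, ABd.1.1 x -> ABd.1.2 y -> ~ ball x ABd.2 y].
  have [|A [B [d H]]] := sep i; last by exists (A, B, d).
  move=> x y Xx mx py Cxy; apply: no; exists i, (connected_component (X i) x).
  split; [by exists x|by exists y|exists x; split=> //].
  exact: connected_component_refl.
have {sep} [ABd sep] := choice sep.
pose A i := (ABd i).1.1; pose B i := (ABd i).1.2.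
pose d := \big[Num.min/1]_i (ABd i).2.
have d0 : 0 < d by apply: lt_bigmin => // i _; have [] := sep i.
have far i x y : A i x -> B i y -> ~ ball x d y.
  move=> Ax By; have [_ _ _ _ H] := sep i; apply: contra_not (H x y Ax By).
  by apply: le_ball; exact: bigmin_le_cond.
have d20 : 0 < d / 2 by rewrite divr_gt0.
(* The successor makes [0 < k] hold by computation. *)
pose k := (Num.bound (d / 2)^-1).+1.
have kd : 1 / k%:R < d / 2.
  rewrite mul1r -[ltRHS]invrK ltf_pV2 ?posrE ?invr_gt0 ?ltr0n //.
  apply: lt_trans (archi_boundP _) _; first by rewrite invr_ge0 ltW.
  by rewrite ltr_nat.
(* With radius [d / 2], no grid point is near both [A i] and [B i], as these would then come within
   [d] of each other. *)
pose a i v := ~~ `[< exists2 u, A i u & ball u (d / 2) (grid_point R k v) >].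
have aB i v x : B i x -> ball (grid_point R k v) (d / 2) x -> a i v.
  move=> Bx vx; apply/asboolPn => -[u Au uv]; apply: (far i u x Au Bx).
  exact: ball_split uv vx.
have aA i v x : A i x -> ball x (d / 2) (grid_point R k v) -> a i v = false.
  by move=> Ax xv; apply/negbTE; rewrite negbK; apply/asboolP; exists x.
have [i v v0|i v vk|p pk H] := @cubical_sperner n k a.
- apply: (aA _ _ (grid_point R k v)); last exact: ballxx.
  have [_ _ + _ _] := sep i; apply; split; first exact: grid_point_cube.
  by rewrite mxE v0 min0n mul0r.
- apply: (aB _ _ (grid_point R k v)); last exact: ballxx.
  have [_ _ _ + _] := sep i; apply; split; first exact: grid_point_cube.
  by rewrite mxE vk minnn divff // pnatr_eq0.
have [i _ Xip] := X_cover _ (@grid_point_cube R n k p isT).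
have [u [v [pu pv /negP]]] := H i; apply; apply/eqP.
have nu := grid_point_near pk pu d20 kd; have nv := grid_point_near pk pv d20 kd.
have [_ /(_ _ Xip)[Ap|Bp] _ _ _] := sep i; first by rewrite !(aA _ _ _ Ap).
by rewrite !(aB _ _ _ Bp) //; exact: ball_sym.
Qed.
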